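(* Let $A\in\mathbb{R}^{n_x\times n_x}$, $D\in\mathbb{R}^{n_x\times n_v}$, $E\in\mathbb{R}^{n_x\times n_w}$, $\Sigma_w\in\mathbb{R}^{n_w\times n_w}$ with $\Sigma_w\succ 0$, $\varepsilon\in(0,1)$ and $d\ge 0$. Consider the discrete-time linear stochastic system $x_{t+1}=Ax_t+Dv_t+Ew_t$, $t\in\mathbb{Z}_{\ge 0}$, with bounded inputs $v_t\in\mathcal{V}=\{v\in\mathbb{R}^{n_v}:\|v\|\le d\}$, and assume that $\|A\|<1$ and $(A,E)$ is reachable. Let $P\succ 0$ be the solution of the Lyapunov equation $APA^\top-P+E\Sigma_wE^\top=0$. For $r>0$ define $\mathcal{D}=\{x\in\mathbb{R}^{n_x}:\|x\|^2-r^2\le 0\}$. If $$r^2>\left(\frac{\|D\|}{1-\|A\|}\,d+\sqrt{\frac1\varepsilon\operatorname{Tr}(P)}\right)^2,$$ then $\mathcal{D}$ is a worst-case CVaR ultimate bound with bounded input for the system, i.e., for every initial state $x_0\in\mathbb{R}^{n_x}$ there exists $T=T(x_0)>0$ such that, for every input sequence with values in $\mathcal{V}$, $$\sup_{\mathbb{P}\in\mathcal{P}_t}\mathbb{P}\text{-CVaR}_\varepsilon[\|x_t\|^2-r^2]\le 0\quad\text{for all } t\ge T.$$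
   Context: $\|\cdot\|$ is the Euclidean norm on vectors and the maximum singular value on matrices; $M\succ 0$ means positive definite. Reachability of $(A,E)$ means $\operatorname{rank}[E, AE,\dots,A^{n_x-1}E]=n_x$. CVaR: for a probability distribution $\mathbb{P}$ of a random vector $\xi$ and a measurable loss $L$, at level $\varepsilon\in(0,1)$, $\mathbb{P}\text{-CVaR}_\varepsilon[L(\xi)]=\inf_{\beta\in\mathbb{R}}\{\beta+\frac1\varepsilon\mathbb{E}_{\mathbb{P}}[(L(\xi)-\beta)^+]\}$, where $x^+=\max\{x,0\}$. The worst-case CVaR over a set of distributions is the supremum of CVaR over that set. Setting: $x_0$ is a given deterministic vector and the disturbances $w_t\in\mathbb{R}^{n_w}$ are i.i.d. with mean zero and covariance $\Sigma_w$, but their distribution is otherwise unknown. The inputs $v_t\in\mathcal{V}$ are treated as an arbitrary bounded disturbance: $v_t$ is any $\mathcal{V}$-valued input, possibly depending (measurably) on $w_0,\dots,w_{t-1}$. For $t\ge 1$ write $\bar w_t=[w_0^\top,\dots,w_{t-1}^\top]^\top\in\mathbb{R}^{n_wt}$; then $x_t=A^tx_0+\sum_{k=0}^{t-1}A^{t-1-k}(Dv_k+Ew_k)$. $\mathcal{P}_t$ is the set of all probability distributions of $\bar w_t$ on $\mathbb{R}^{n_wt}$ with mean zero and covariance $I_t\otimes\Sigma_w$. Definition: for $f:\mathbb{R}^{n_x}\to\mathbb{R}$, the set $\{x: f(x)\le 0\}$ is a worst-case CVaR ultimate bound with bounded input if for every $x_0$ there is $T=T(x_0)>0$ with $\sup_{\mathbb{P}\in\mathcal{P}_t}\mathbb{P}\text{-CVaR}_\varepsilon[f(x_t)]\le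 0$ for all $t\ge T$ (for all admissible inputs); here $f(x)=\|x\|^2-r^2$. *)

(* Defs.v *)
From HB Require Import structures.
From mathcomp Require Import all_boot all_order all_algebra.
From mathcomp Require Import mxtens.
From mathcomp Require Import all_classical all_reals all_analysis.

Set Implicit Arguments.
Unset Strict Implicit.
Unset Printing Implicit Defensive.

Import Order.TTheory GRing.Theory Num.Theory.
Import numFieldNormedType.Exports.

Local Open Scope classical_set_scope.
Local Open Scope ring_scope.

(** ** Linear algebra *)

(** The library norm on matrices is the max norm, hence this definition. *)
Definition enorm (R : realType) (n : nat) (x : 'cV[R]_n) : R :=
  Num.sqrt (\sum_(i < n) x i 0 ^+ 2).

(** For wide matrices this adds at most the value 0 to the usual list of
    singular values, which does not affect the maximum. *)
Definition singular_value (R : realType) (m n : nat) (M : 'M[R]_(m, n))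
    (s : R) : Prop :=
  exists2 a, eigenvalue (M^T *m M) a & s = Num.sqrt a.

(** The set of singular values is finite, so [sup] is a maximum; a matrix
    without columns has none, and its norm is then [sup set0 = 0]. *)
Definition specnorm (R : realType) (m n : nat) (M : 'M[R]_(m, n)) : R :=
  sup [set s | singular_value M s].

Definition posdef (R : realType) (n : nat) (M : 'M[R]_n) : Prop :=
  M^T = M /\ forall x : 'cV[R]_n, x != 0 -> 0 < (x^T *m M *m x) 0 0.

Definition reachable (R : realType) (nx nw : nat) (A : 'M[R]_nx)
    (E : 'M[R]_(nx, nw)) : Prop :=
  \rank (\mxrow_(i < nx) (A ^+ i *m E)) = nx.

(** ** Probability on R^n *)

(** R^n with its Borel sigma-algebra. *)
Definition borelcV (R : realType) (n : nat) :=
  g_sigma_algebraType (@open 'cV[R]_n).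

(** A covariance equal to a finite value forces square integrability of the
    coordinates, since an undefined integral is infinite. *)
Definition has_mean0_cov (R : realType) (n : nat) (S : 'M[R]_n)
    (P : probability (borelcV R n) R) : Prop :=
  (forall i : 'I_n, 'E_P[fun w : 'cV[R]_n => w i 0%R] = 0)%E /\
  (forall i j : 'I_n,
     covariance P (fun w : 'cV[R]_n => w i 0) (fun w : 'cV[R]_n => w j 0)
     = (S i j)%:E).

Definition cvar (R : realType) (d : measure_display) (T : measurableType d)
    (P : probability T R) (eps : R) (L : T -> R) : \bar R :=
  ereal_inf
    [set (beta%:E + (1 / eps)%R%:E * 'E_P[fun w => Num.max (L w - beta)%R 0%R])%E
    | beta in [set: R]].

Definition worst_case_cvar (R : realType) (d : measure_display)
    (T : measurableType d) (PP : set (probability T R)) (eps : R)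
    (L : T -> R) : \bar R :=
  ereal_sup [set cvar P eps L | P in PP].

(** The set of distributions of the stacked disturbance
    [w_0; ...; w_(t-1)]; [*t] is the Kronecker product. *)
Definition ambiguity (R : realType) (nw : nat) (Sw : 'M[R]_nw) (t : nat) :
    set (probability (borelcV R (t * nw)) R) :=
  [set P | has_mean0_cov ((1%:M : 'M[R]_t) *t Sw) P].

(** ** The controlled system *)

(** Block k occupies the coordinates k * nw, ..., k * nw + nw - 1, the ordering
    used by [*t]. *)
Definition stack (R : realType) (nw t : nat) (w : nat -> 'cV[R]_nw) :
    'cV[R]_(t * nw) :=
  \col_i w (mxtens_unindex i).1 (mxtens_unindex i).2 0.

(** The sequence of blocks of a stacked vector, extended by 0 from index t on;
    the state at time t does not depend on this extension. *)
Definition unstack (R : realType) (nw t : nat) (wbar : 'cV[R]_(t * nw)) :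
    nat -> 'cV[R]_nw :=
  fun k => if insub k is Some k' then \col_i wbar (mxtens_index (k' : 'I_t, i)) 0
           else 0.

(** The input at time k is a function of the stacked disturbances
    w_0, ..., w_(k-1); at k = 0 it is a constant. *)
Definition input_seq (R : realType) (nv nw : nat) : Type :=
  forall k : nat, 'cV[R]_(k * nw) -> 'cV[R]_nv.

Definition admissible (R : realType) (nv nw : nat) (d : R)
    (v : input_seq R nv nw) : Prop :=
  forall k : nat,
    measurable_fun [set: borelcV R (k * nw)]
      (v k : borelcV R (k * nw) -> borelcV R nv) /\
    forall wbar : 'cV[R]_(k * nw), enorm (v k wbar) <= d.

Fixpoint trajectory (R : realType) (nx nv nw : nat) (A : 'M[R]_nx)
    (D : 'M[R]_(nx, nv)) (E : 'M[R]_(nx, nw)) (x0 : 'cV[R]_nx)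
    (v : input_seq R nv nw) (w : nat -> 'cV[R]_nw) (t : nat) : 'cV[R]_nx :=
  match t with
  | 0%N => x0
  | k.+1 => A *m trajectory A D E x0 v w k + D *m v k (stack k w) + E *m w k
  end.

Definition state (R : realType) (nx nv nw : nat) (A : 'M[R]_nx)
    (D : 'M[R]_(nx, nv)) (E : 'M[R]_(nx, nw)) (x0 : 'cV[R]_nx)
    (v : input_seq R nv nw) (t : nat) (wbar : 'cV[R]_(t * nw)) : 'cV[R]_nx :=
  trajectory A D E x0 v (unstack wbar) t.

(** The set [set x | f x <= 0] is a worst-case CVaR ultimate bound with bounded
    input. The time T depends on x0 only, not on the input. *)
Definition cvar_ultimate_bound (R : realType) (nx nv nw : nat) (A : 'M[R]_nx)
    (D : 'M[R]_(nx, nv)) (E : 'M[R]_(nx, nw)) (Sw : 'M[R]_nw) (eps d : R)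
    (f : 'cV[R]_nx -> R) : Prop :=
  forall x0 : 'cV[R]_nx, exists2 T : nat, (0 < T)%N &
    forall v : input_seq R nv nw, admissible d v ->
    forall t : nat, (T <= t)%N ->
      (worst_case_cvar (ambiguity Sw (t := t)) eps
         (fun wbar : borelcV R (t * nw) => f (state A D E x0 v wbar)) <= 0)%E.

(* Main.v *)
Require Import Defs.
From HB Require Import structures.
From mathcomp Require Import all_boot all_order all_algebra.
From mathcomp Require Import mxtens ring lra.
From mathcomp Require Import all_classical all_reals all_analysis.
From mathcomp Require Import measurable_realfun.

(** Split the state into the part driven by the initial state and the inputs,
    which is at most [|A|^t |x0| + |D| d / (1 - |A|)] pathwise, and the part
    driven by the noise, whose second moment is at most [tr P] because the
    partial sums of [A^k E Sw E^T (A^k)^T] are dominated by the Lyapunov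
    solution. For [l > 0],
    [|y + z|^2 <= (1 + 1/l) |y|^2 + (1 + l) |z|^2], and taking the first term
    (minus [r^2]) as the parameter beta of the CVaR bounds it by
    [(1 + 1/l) b^2 + (1 + l) s^2 - r^2], with [b] the bound on [|y|] and
    [s^2] a bound on [tr P / eps]. At [l = b / s] this is [(b + s)^2 - r^2]. *)

Set Implicit Arguments.
Unset Strict Implicit.
Unset Printing Implicit Defensive.

Import Order.TTheory GRing.Theory Num.Theory.
Import numFieldNormedType.Exports.

Local Open Scope classical_set_scope.
Local Open Scope ring_scope.

(** * Euclidean norm: Cauchy-Schwarz, triangle inequality and a weighted square bound *)

Lemma sqr_enorm (R : realType) (n : nat) (x : 'cV[R]_n) :
  enorm x ^+ 2 = \sum_(i < n) x i 0 ^+ 2.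
Proof. by rewrite sqr_sqrtr// sumr_ge0// => i _; exact: sqr_ge0. Qed.

Lemma sqr_enorm_mulmx (R : realType) (n : nat) (x : 'cV[R]_n) :
  enorm x ^+ 2 = (x^T *m x) 0 0.
Proof.
by rewrite sqr_enorm mxE; apply: eq_bigr => i _; rewrite mxE expr2.
Qed.

Lemma enorm_ge0 (R : realType) (n : nat) (x : 'cV[R]_n) : 0 <= enorm x.
Proof. exact: sqrtr_ge0. Qed.

Lemma enorm_eq0 (R : realType) (n : nat) (x : 'cV[R]_n) :
  (enorm x == 0) = (x == 0).
Proof.
apply/idP/eqP => [/eqP x0|->].
  have := sqr_enorm x; rewrite x0 expr0n/= => /esym/eqP.
  rewrite psumr_eq0 => [|i _]; last exact: sqr_ge0.
  move=> /allP h; apply/matrixP => i j; rewrite ord1 mxE.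
  by apply/eqP; rewrite -sqrf_eq0; apply: h; rewrite mem_index_enum.
rewrite /enorm big1 ?sqrtr0// => i _.
by rewrite mxE expr0n.
Qed.

(** Cauchy-Schwarz, by expanding the sum of the squares of [|y| x_i - |x| y_i]. Zero vectors are set
    apart so that the factor [2 |x| |y|] can be cancelled. *)
Lemma sum_mul_le_enorm (R : realType) (n : nat) (x y : 'cV[R]_n) :
  \sum_(i < n) x i 0 * y i 0 <= enorm x * enorm y.
Proof.
have [->|x0] := eqVneq x 0.
  by rewrite big1 ?mulr_ge0 ?enorm_ge0// => i _; rewrite mxE mul0r.
have [->|y0] := eqVneq y 0.
  by rewrite big1 ?mulr_ge0 ?enorm_ge0// => i _; rewrite mxE mulr0.
have p0 : 0 < enorm x by rewrite lt_def enorm_eq0 x0 enorm_ge0.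
have q0 : 0 < enorm y by rewrite lt_def enorm_eq0 y0 enorm_ge0.
have px := sqr_enorm x; have qy := sqr_enorm y.
set p := enorm x in p0 px *; set q := enorm y in q0 qy *.
set s := \sum_(i < n) _.
have : 0 <= \sum_(i < n) (q * x i 0 - p * y i 0) ^+ 2.
  by apply: sumr_ge0 => i _; exact: sqr_ge0.
have -> : \sum_(i < n) (q * x i 0 - p * y i 0) ^+ 2 =
    q ^+ 2 * p ^+ 2 - (p * q *+ 2) * s + p ^+ 2 * q ^+ 2.
  rewrite px qy !mulr_sumr -sumrB -big_split/= -px -qy.
  by apply: eq_bigr => i _; ring.
have -> : q ^+ 2 * p ^+ 2 - p * q *+ 2 * s + p ^+ 2 * q ^+ 2 =
  (p * q *+ 2) * (p * q - s) by ring.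
by rewrite pmulr_rge0 ?subr_ge0// mulrn_wgt0// mulr_gt0.
Qed.

Lemma enormD (R : realType) (n : nat) (x y : 'cV[R]_n) :
  enorm (x + y) <= enorm x + enorm y.
Proof.
rewrite -(@ler_pXn2r _ 2)// ?nnegrE ?addr_ge0 ?enorm_ge0//.
rewrite sqrrD !sqr_enorm.
under eq_bigr do rewrite mxE sqrrD.
rewrite 2!big_split/= lerD2r lerD2l sumrMnl lerMn2r/=.
exact: sum_mul_le_enorm.
Qed.

(** In each coordinate the gap between the two sides is [l^-1 * (a - l * b) ^+ 2]. The weight [l]
    stays free and is tuned at the very end. *)
Lemma sqr_enormD_le (R : realType) (n : nat) (l : R) (x y : 'cV[R]_n) :
  0 < l -> enorm (x + y) ^+ 2
  <= (1 + l^-1) * enorm x ^+ 2 + (1 + l) * enorm y ^+ 2.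
Proof.
move=> l0; rewrite !sqr_enorm !mulr_sumr -big_split/=; apply: ler_sum => i _.
rewrite mxE; set a := x i 0; set b := y i 0.
have -> : (1 + l^-1) * a ^+ 2 + (1 + l) * b ^+ 2 =
  (a + b) ^+ 2 + l^-1 * (a - l * b) ^+ 2.
  by field; rewrite gt_eqF.
by rewrite lerDl mulr_ge0 ?sqr_ge0// invr_ge0 ltW.
Qed.

(** * The spectral norm as an operator bound *)

(** The quadratic form attains a maximum [a] on the compact unit sphere, and homogeneity extends the
    bound to all vectors. The argument runs on row vectors because [eigenvalue] refers to left
    eigenvectors; the size [n.+1] makes the sphere nonempty. *)
Lemma Rayleigh_max (R : realType) (n : nat) (S : 'M[R]_n.+1) : S^T = S ->
  exists a, eigenvalue S a /\
    forall x : 'cV[R]_n.+1, (x^T *m S *m x) 0 0 <= a * enorm x ^+ 2.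
Proof.
move=> symS.
pose q (M : 'M[R]_n.+1) (x : 'rV[R]_n.+1) := (x *m M *m x^T) 0 0.
have qE M x : q M x = \sum_j (\sum_k x 0 k * M k j) * x 0 j.
  by rewrite /q mxE; apply: eq_bigr => j _; rewrite !mxE.
have qZ M t x : q M (t *: x) = t ^+ 2 * q M x.
  by rewrite /q linearZ/= -scalemxAl -!scalemxAr -scalemxAl !mxE mulrA expr2.
have q1E x : q 1%:M x = \sum_j x 0 j ^+ 2.
  by rewrite /q mulmx1 mxE; apply: eq_bigr => j _; rewrite mxE expr2.
have q1_ge0 x : 0 <= q 1%:M x.
  by rewrite q1E sumr_ge0// => j _; exact: sqr_ge0.
have qcont M : continuous (q M).
  have -> : q M = (fun x => \sum_j (\sum_k x 0 k * M k j) * x 0 j).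
    by apply/funext => x; exact: qE.
  apply: continuous_big => [|j _ x]; first exact: add_continuous.
  apply: continuousM; last exact: coord_continuous.
  apply: continuous_big => [|k _ y]; first exact: add_continuous.
  by apply: continuousM; [exact: coord_continuous|exact: cst_continuous].
pose B : set 'rV[R]_n.+1 := [set x | q 1%:M x = 1].
have B0 : B !=set0.
  exists (delta_mx 0 0); rewrite /B/= q1E (bigD1 0)//= big1 => [|j j0].
    by rewrite mxE !eqxx expr1n addr0.
  by rewrite mxE (negbTE j0) andbF expr0n.
have cB : compact B.
  apply: bounded_closed_compact.
    (* Boundedness refers to the max norm: each squared coordinate is at most the sum of squares,
       which is 1. *)
    exists 1; split => //= M M1 x /= Bx; apply/(le_trans _ (ltW M1)).
    rewrite [leLHS]mx_normrE; apply/bigmax_leP; split => // -[i j] _ /=.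
    rewrite ord1.
    rewrite -(@ler_pXn2r _ 2)// ?nnegrE//.
    rewrite real_normK ?num_real// expr1n -[X in _ <= X]Bx q1E (bigD1 j)//=.
    by rewrite lerDl sumr_ge0// => k _; exact: sqr_ge0.
  have -> : B = q 1%:M @^-1` [set 1] by [].
  apply: closed_comp => [x _|]; first exact: qcont.
  exact: closed_eq.
have [u uB umax] := compact_EVT_max B0 cB
  (continuous_subspaceT (qcont S)).
move: uB; rewrite inE => uB.
set a := q S u in umax.
have bound x : q S x <= a * q 1%:M x.
  have [x0|] := eqVneq (q 1%:M x) 0.
    have -> : x = 0.
      apply/matrixP => i j; rewrite ord1 mxE; apply/eqP; rewrite -sqrf_eq0.
      move: x0; rewrite q1E => /eqP; rewrite psumr_eq0 => [|k _].
        by move=> /allP; apply; rewrite mem_index_enum.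
      exact: sqr_ge0.
    by rewrite /q !mul0mx !mxE mulr0.
  move=> x0; have px : 0 < q 1%:M x by rewrite lt_def x0 q1_ge0.
  have := umax ((Num.sqrt (q 1%:M x))^-1 *: x).
  rewrite inE /B/= !qZ exprVn sqr_sqrtr// mulVf// => /(_ erefl).
  by rewrite ler_pdivrMl// mulrC.
exists a; split; last first.
  move=> x; have := bound x^T; rewrite /q trmxK mulmx1.
  by rewrite sqr_enorm_mulmx.
(* The form [Q] is positive semidefinite and vanishes at [u]; hence [u] is in
   its kernel, which makes [a] an eigenvalue. *)
pose Q := a%:M - S.
have Qge0 x : 0 <= q Q x.
  have -> : q Q x = a * q 1%:M x - q S x.
    rewrite /q /Q mulmxBr mulmxBl mxE [X in _ + X]mxE; congr (_ - _).
    by rewrite -scalemx1 -scalemxAr -scalemxAl mxE.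
  by rewrite subr_ge0.
have Qu : q Q u = 0.
  rewrite /q /Q mulmxBr mulmxBl mxE [X in _ + X]mxE.
  rewrite -scalemx1 -scalemxAr -scalemxAl mxE -/(q _ _) uB mulr1.
  exact: subrr.
have symQ : Q^T = Q by rewrite /Q linearB/= tr_scalar_mx symS.
have QE : Q = a%:M - S by [].
clearbody Q.
have [y yE] : exists y, y = u *m Q by exists (u *m Q).
pose b := (y *m y^T) 0 0.
have b0 : b = 0.
  have polar t : q Q (u + t *: y) = t ^+ 2 * q Q y + 2 * t * b.
    have -> : q Q (u + t *: y) =
        (u *m Q *m u^T + t *: (y *m y^T) + t *: (y *m y^T)
         + t ^+ 2 *: (y *m Q *m y^T)) 0 0.
      have yyE : y *m y^T = y *m Q *m u^T.
        by rewrite [in y^T]yE trmx_mul symQ mulmxA.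
      rewrite /q [(u + _)^T]linearD/= [(t *: y)^T]linearZ/= !mulmxDl !mulmxDr.
      by rewrite -yE -!scalemxAl -!scalemxAr scalerA -expr2 -!addrA -yyE.
    move: Qu; rewrite /q /b !mxE => ->.
    ring.
  have c0 := Qge0 y; set c := q Q y in c0 polar.
  (* A nonnegative quadratic in [t] without constant term has no linear term. The near-minimizer
     [- b / (c + 1)] replaces [- b / c], since [c] may be 0. *)
  have := Qge0 (u + (- b / (c + 1)) *: y); rewrite polar.
  have -> : (- b / (c + 1)) ^+ 2 * c + 2 * (- b / (c + 1)) * b =
      - (b / (c + 1)) ^+ 2 * (c + 2).
    by field; rewrite gt_eqF// ltr_wpDl.
  have c2 : 0 < c + 2 by rewrite ltr_wpDl.
  have c1 : c + 1 != 0 by rewrite gt_eqF// ltr_wpDl.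
  rewrite pmulr_lge0// oppr_ge0 => h.
  have : (b / (c + 1)) ^+ 2 == 0 by rewrite eq_le h sqr_ge0.
  by rewrite sqrf_eq0 mulf_eq0 invr_eq0 (negbTE c1) orbF => /eqP.
have y0 : y = 0.
  apply/eqP; rewrite -trmx_eq0 -enorm_eq0 -sqrf_eq0 sqr_enorm_mulmx trmxK.
  exact/eqP.
apply/eigenvalueP; exists u.
  by move/eqP: y0; rewrite yE QE mulmxBr mul_mx_scalar subr_eq0 eq_sym => /eqP.
apply: contra_eq_neq uB => ->.
by rewrite /q !mul0mx mxE eq_sym oner_eq0.
Qed.

(** The Rayleigh maximum [a] of [M^T *m M] controls [|M z|^2], and its square root is a singular
    value. The supremum dominates it because the set is bounded: testing [a] on an eigenvector shows
    that no eigenvalue exceeds it. *)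
Lemma enorm_mulmx_le (R : realType) (m n : nat) (M : 'M[R]_(m, n))
    (x : 'cV[R]_n) : enorm (M *m x) <= specnorm M * enorm x.
Proof.
case: n M x => [|n] M x.
  have -> : M *m x = 0.
    by apply/matrixP => i j; rewrite !mxE big_ord0.
  have /eqP -> : enorm (0 : 'cV[R]_m) == 0 by rewrite enorm_eq0.
  have /eqP -> : enorm x == 0 by rewrite enorm_eq0; apply/eqP/matrixP => -[].
  by rewrite mulr0.
have sqE (z : 'cV[R]_n.+1) :
    enorm (M *m z) ^+ 2 = (z^T *m (M^T *m M) *m z) 0 0.
  by rewrite sqr_enorm_mulmx trmx_mul !mulmxA.
have [a [eva amax]] : exists a, eigenvalue (M^T *m M) a /\ forall z : 'cV_n.+1,
    enorm (M *m z) ^+ 2 <= a * enorm z ^+ 2.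
  have [|a [eva amax]] := @Rayleigh_max R n (M^T *m M).
    by rewrite trmx_mul trmxK.
  by exists a; split => // z; rewrite sqE.
have a_le : Num.sqrt a <= specnorm M.
  apply: ub_le_sup; last by exists a.
  exists (Num.sqrt a) => _ [b /eigenvalueP[v vb v0] ->].
  apply: ler_wsqrtr.
  have : 0 < enorm v^T ^+ 2.
    by rewrite exprn_gt0// lt_def enorm_ge0 andbT enorm_eq0 trmx_eq0.
  move=> v0'; rewrite -(ler_pM2r v0'); apply: le_trans (amax v^T).
  rewrite sqE trmxK vb -scalemxAl mxE sqr_enorm_mulmx trmxK.
  exact: lexx.
apply: le_trans (ler_wpM2r (enorm_ge0 x) a_le).
(* For [a < 0] the square root is 0 by convention, and the bound on [|M x|^2] forces [M x] to
   vanish. *)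
have [a0|a0] := leP 0 a.
  rewrite -(@ler_pXn2r _ 2)// ?nnegrE ?mulr_ge0 ?enorm_ge0 ?sqrtr_ge0//.
  by rewrite exprMn (sqr_sqrtr a0) amax.
have := le_trans (amax x) (mulr_le0_ge0 (ltW a0) (sqr_ge0 _)).
rewrite ltr0_sqrtr// mul0r => h.
have : enorm (M *m x) ^+ 2 == 0 by rewrite eq_le h sqr_ge0.
by rewrite sqrf_eq0 => /eqP ->.
Qed.

(** When the set has no supremum, [sup] takes the default value 0; otherwise it dominates some
    square root. *)
Lemma specnorm_ge0 (R : realType) (m n : nat) (M : 'M[R]_(m, n)) :
  0 <= specnorm M.
Proof.
rewrite /specnorm; have [[[s sM] ub]|/sup_out ->//] :=
  pselect (has_sup [set s | singular_value M s]).
apply: le_trans (ub_le_sup ub sM).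
by case: sM => a _ ->; exact: sqrtr_ge0.
Qed.

(** * Splitting of the trajectory and the Lyapunov equation *)

Section system.
Variables (R : realType) (nx nv nw : nat).
Variables (A : 'M[R]_nx) (D : 'M[R]_(nx, nv)) (E : 'M[R]_(nx, nw)).

(** The inputs form a plain sequence here: the bound is pathwise, so their dependence on the noise
    can be forgotten. *)
Fixpoint forced_part (x0 : 'cV[R]_nx) (u : nat -> 'cV[R]_nv) (t : nat) :=
  if t is k.+1 then A *m forced_part x0 u k + D *m u k else x0.

Definition noise_part (w : nat -> 'cV[R]_nw) (t : nat) : 'cV[R]_nx :=
  \sum_(k < t) (A ^+ (t.-1 - k) *m E *m w k).

Lemma noise_partS w t :
  noise_part w t.+1 = A *m noise_part w t + E *m w t.
Proof.
rewrite /noise_part big_ord_recr/= subnn expr0 mul1mx; congr (_ + _).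
rewrite mulmx_sumr; apply: eq_bigr => k _ /=.
have -> : (t - k = (t.-1 - k).+1)%N.
  by case: t k => [[]//|t k]; rewrite subSn// -ltnS.
by rewrite exprS -!mulmxE !mulmxA.
Qed.

Lemma trajectory_split x0 (v : input_seq R nv nw) w t :
  trajectory A D E x0 v w t =
  forced_part x0 (fun k => v k (stack k w)) t + noise_part w t.
Proof.
elim: t => [|t ih]; first by rewrite /noise_part big_ord0 addr0.
by rewrite noise_partS /= ih mulmxDr addrA; congr (_ + _); rewrite addrAC.
Qed.

(** The constant [|D| d / (1 - |A|)] is the fixed point of [c |-> |A| c + |D| d], so the induction
    step ends in an equality. *)
Lemma enorm_forced_part (d : R) x0 u t :
  specnorm A < 1 -> (forall k, enorm (u k) <= d) ->
  enorm (forced_part x0 u t) <=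
  specnorm A ^+ t * enorm x0 + specnorm D / (1 - specnorm A) * d.
Proof.
move=> A1 ud; have d0 : 0 <= d by exact: le_trans (enorm_ge0 _) (ud 0%N).
have A1' : 0 < 1 - specnorm A by rewrite subr_gt0.
set a := specnorm A in A1 A1' *.
elim: t => [|t ih].
  by rewrite expr0 mul1r lerDl !mulr_ge0 ?invr_ge0 ?specnorm_ge0// ltW.
apply: le_trans (enormD _ _) _.
apply: (@le_trans _ _ (a * enorm (forced_part x0 u t) + specnorm D * d)).
  apply: lerD; first exact: enorm_mulmx_le.
  apply: le_trans (enorm_mulmx_le _ _) _.
  by apply: ler_wpM2l (ud t); exact: specnorm_ge0.
apply: (@le_trans _ _ (a * (a ^+ t * enorm x0 + specnorm D / (1 - a) * d)
                       + specnorm D * d)).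
  by rewrite lerD2r; apply: ler_wpM2l ih; exact: specnorm_ge0.
rewrite le_eqVlt; apply/orP; left; apply/eqP.
by rewrite exprS; field; rewrite gt_eqF.
Qed.

(** Each step substitutes the equation for the [P] inside the remainder [A^t P (A^t)^T], which
    releases one more summand. *)
Lemma lyapunov_iter (S : 'M[R]_nw) (P : 'M[R]_nx) t :
  A *m P *m A^T - P + E *m S *m E^T = 0 ->
  P = A ^+ t *m P *m (A ^+ t)^T +
    \sum_(k < t) (A ^+ k *m E *m S *m (A ^+ k *m E)^T).
Proof.
move=> lyap; have PE : P = A *m P *m A^T + E *m S *m E^T.
  by apply/eqP; rewrite eq_sym -subr_eq0 addrAC lyap.
elim: t => [|t ih].
  by rewrite big_ord0 addr0 expr0 trmx1 mulmx1 mul1mx.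
rewrite {1}ih {1}PE big_ord_recr/= mulmxDr mulmxDl addrA addrAC.
by rewrite !exprSr !trmx_mul !mulmxA.
Qed.

(** The remainder [A^t P (A^t)^T] has nonnegative diagonal entries, being values of the form of [P]
    at the rows of [A^t]. *)
Lemma trace_lyapunov_sum_le (S : 'M[R]_nw) (P : 'M[R]_nx) t :
  posdef P -> A *m P *m A^T - P + E *m S *m E^T = 0 ->
  \tr (\sum_(k < t) (A ^+ k *m E *m S *m (A ^+ k *m E)^T)) <= \tr P.
Proof.
move=> [_ Ppos] /(lyapunov_iter t) PE.
rewrite [in leRHS]PE mxtraceD lerDr; apply: sumr_ge0 => i _.
set B := A ^+ t.
have -> : (B *m P *m B^T) i i = ((row i B)^T^T *m P *m (row i B)^T) 0 0.
  by rewrite trmxK -row_mul [LHS]mxE [RHS]mxE; apply: eq_bigr => j _;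
    rewrite !mxE.
have [->|z0] := eqVneq (row i B)^T 0; first by rewrite mulmx0 mxE.
exact/ltW/Ppos.
Qed.

End system.

(** * Bounding the CVaR by an integral *)

(** The library's [ge0_le_integral] needs measurability; this version spares us
    the measurability of the closed-loop state. *)
Lemma ge0_le_integral_sup d (T : measurableType d) (R : realType)
    (mu : {measure set T -> \bar R}) (f g : T -> \bar R) :
  (forall x, 0 <= f x)%E -> (forall x, f x <= g x)%E ->
  (\int[mu]_x f x <= \int[mu]_x g x)%E.
Proof.
move=> f0 fg; have g0 x : (0 <= g x)%E by exact: le_trans (fg x).
rewrite !ge0_integralTE//; apply: ge_ereal_sup => _ [h hf <-].
by apply: ereal_sup_ubound; exists h => // x; exact: le_trans (fg x).
Qed.

(** The infimum is at most its value at the given [beta], where the positive part of [L - beta] is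
    dominated by [K]. *)
Lemma cvar_le d (T : measurableType d) (R : realType) (P : probability T R)
    (eps beta c : R) (L K : T -> R) :
  0 < eps -> (forall w, 0 <= K w) -> (forall w, L w <= beta + K w) ->
  (\int[P]_w (K w)%:E <= c%:E)%E ->
  (cvar P eps L <= (beta + c / eps)%:E)%E.
Proof.
move=> eps0 K0 LK Kc; have : (cvar P eps L <= beta%:E + (1 / eps)%R%:E *
    'E_P[fun w => Num.max (L w - beta)%R 0%R])%E.
  by apply: ereal_inf_lbound; exists beta.
move/le_trans; apply.
rewrite [c / eps]mulrC -[eps^-1 in leRHS]div1r EFinD leeD2l// [leRHS]EFinM.
apply: lee_wpmul2l.
  by rewrite lee_fin divr_ge0// ltW.
apply: le_trans Kc; rewrite unlock; apply: ge0_le_integral_sup => w.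
  by rewrite lee_fin le_max lexx orbT.
by rewrite lee_fin ge_max K0 lerBlDl LK.
Qed.

(** * Second moments of linear images of a random vector *)

Lemma measurable_coord (R : realType) (n : nat) (i : 'I_n) :
  measurable_fun [set: borelcV R n] (fun w : 'cV[R]_n => w i 0).
Proof.
apply: (measurability _ (RGenOpens.measurableE R)).
move=> _ [_ [a [b ->] <-]]; rewrite setTI; apply: sub_sigma_algebra.
apply: open_comp; last exact: interval_open.
by move=> x _; exact: coord_continuous.
Qed.

Section second_moments.
Variables (R : realType) (n : nat) (S : 'M[R]_n).
Variable P : probability (borelcV R n) R.
Hypothesis PS : has_mean0_cov S P.

Lemma integral_coord_mul i j :
  (\int[P]_w ((w : 'cV[R]_n) i 0 * (w : 'cV[R]_n) j 0)%:E = (S i j)%:E)%E.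
Proof.
have [m0 cS] := PS; rewrite -cS unlock !m0 unlock/=.
by apply: eq_integral => w _ /=; rewrite fctE /= !subr0.
Qed.

Lemma measurable_coord_mul i j : measurable_fun [set: borelcV R n]
  (fun w : borelcV R n => (w : 'cV[R]_n) i 0 * (w : 'cV[R]_n) j 0).
Proof. by apply: measurable_funM; exact: measurable_coord. Qed.

(** The squares are integrable because the diagonal covariances are finite, and [|a b| <= a^2 + b^2]
    gives the mixed products. *)
Lemma integrable_coord_mul i j : P.-integrable [set: borelcV R n]
  (fun w : borelcV R n => ((w : 'cV[R]_n) i 0 * (w : 'cV[R]_n) j 0)%:E).
Proof.
have sq k : P.-integrable [set: borelcV R n]
    (fun w : borelcV R n => ((w : 'cV[R]_n) k 0 * (w : 'cV[R]_n) k 0)%:E).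
  apply/integrableP; split.
    by apply/measurable_EFinP; exact: measurable_coord_mul.
  under eq_integral do rewrite gee0_abs ?lee_fin -?expr2 ?sqr_ge0// expr2.
  by rewrite integral_coord_mul ltry.
have := integrableD measurableT (sq i) (sq j).
apply: le_integrable => //.
  by apply/measurable_EFinP; exact: measurable_coord_mul.
move=> w _; rewrite -EFinD !abse_EFin lee_fin.
set a := (w : 'cV[R]_n) i 0; set b := (w : 'cV[R]_n) j 0.
rewrite [leRHS]ger0_norm -?expr2 ?addr_ge0 ?sqr_ge0//.
rewrite ler_norml; apply/andP; split.
  have := sqr_ge0 (a + b); have := sqr_ge0 a; have := sqr_ge0 b; nra.
have := sqr_ge0 (a - b); have := sqr_ge0 a; have := sqr_ge0 b; nra.
Qed.

Lemma sqr_enorm_mulmx_expand m (G : 'M[R]_(m, n)) (w : 'cV[R]_n) :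
  ((enorm (G *m w) ^+ 2)%:E
   = \sum_i \sum_k \sum_j (G i k * G i j)%:E * (w k 0 * w j 0)%:E)%E.
Proof.
rewrite sqr_enorm -sumEFin.
apply: eq_bigr => i _; rewrite expr2 mxE mulr_suml -sumEFin.
apply: eq_bigr => k _; rewrite mulr_sumr -sumEFin.
by apply: eq_bigr => j _; rewrite -EFinM; congr EFin; ring.
Qed.

Let integrable_coef (a : R) k j : P.-integrable [set: borelcV R n]
  (fun w : borelcV R n =>
    (a%:E * ((w : 'cV[R]_n) k 0 * (w : 'cV[R]_n) j 0)%:E)%E).
Proof. exact/integrableZl/integrable_coord_mul. Qed.

Lemma integrable_sqr_enorm_mulmx m (G : 'M[R]_(m, n)) :
  P.-integrable [set: borelcV R n]
    (fun w : borelcV R n => (enorm (G *m (w : 'cV[R]_n)) ^+ 2)%:E).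
Proof.
under eq_fun do rewrite sqr_enorm_mulmx_expand.
apply: integrable_sum => // i _; apply: integrable_sum => // k _.
exact: integrable_sum.
Qed.

Lemma integral_sqr_enorm_mulmx m (G : 'M[R]_(m, n)) :
  (\int[P]_w (enorm (G *m (w : 'cV[R]_n)) ^+ 2)%:E
   = (\tr (G *m S *m G^T))%:E)%E.
Proof.
under eq_integral do rewrite sqr_enorm_mulmx_expand.
rewrite integral_sum//=; last first.
  by move=> i; apply: integrable_sum => // k _; exact: integrable_sum.
rewrite -sumEFin; apply: eq_bigr => i _.
rewrite integral_sum//; last by move=> k; exact: integrable_sum.
rewrite mxE; under [in RHS]eq_bigr do rewrite mxE mulr_suml.
rewrite exchange_big -sumEFin; apply: eq_bigr => k _.
rewrite integral_sum// -sumEFin; apply: eq_bigr => j _.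
rewrite integralZl//; last exact: integrable_coord_mul.
by rewrite integral_coord_mul -EFinM mxE; congr EFin; ring.
Qed.

End second_moments.

(** * The noise part as a linear image of the stacked disturbance *)

Section stacked_noise.
Variables (R : realType) (nx nw : nat).
Variables (A : 'M[R]_nx) (E : 'M[R]_(nx, nw)).

(** The block row [[A^(t-1) E, ..., A E, E]], indexed in the ordering of [stack]. *)
Definition noise_gain t : 'M[R]_(nx, t * nw) :=
  \matrix_(i, l)
    (A ^+ (t.-1 - (mxtens_unindex l).1) *m E) i (mxtens_unindex l).2.

Lemma unstackE t (wbar : 'cV[R]_(t * nw)) (k : 'I_t) :
  unstack wbar k = \col_i wbar (mxtens_index (k, i)) 0.
Proof. by rewrite /unstack valK. Qed.

Lemma big_mxtens t (F : 'I_(t * nw) -> R) :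
  \sum_l F l = \sum_(k < t) \sum_(j < nw) F (mxtens_index (k, j)).
Proof.
rewrite pair_bigA/= (reindex (@mxtens_index t nw))/=.
  by apply: eq_bigr => -[].
exists (@mxtens_unindex t nw) => l _; first exact: mxtens_indexK.
exact: mxtens_unindexK.
Qed.

Lemma noise_part_unstack t (wbar : 'cV[R]_(t * nw)) :
  noise_part A E (unstack wbar) t = noise_gain t *m wbar.
Proof.
apply/matrixP => i j; rewrite ord1 [RHS]mxE big_mxtens summxE.
apply: eq_bigr => k _; rewrite unstackE mxE; apply: eq_bigr => l _.
by rewrite !mxE mxtens_indexK.
Qed.

(** The Kronecker product with the identity is block diagonal, so only pairs of equal times
    contribute. Reversing time turns the powers [t - 1 - k] into [k]. *)
Lemma trace_noise_gain (S : 'M[R]_nw) t :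
  \tr (noise_gain t *m ((1%:M : 'M[R]_t) *t S) *m (noise_gain t)^T) =
  \tr (\sum_(k < t) (A ^+ k *m E *m S *m (A ^+ k *m E)^T)).
Proof.
rewrite raddf_sum/= (reindex_inj rev_ord_inj)/=.
rewrite /mxtrace exchange_big/=; apply: eq_bigr => i _.
rewrite mxE big_mxtens; apply: eq_bigr => k _.
rewrite mxE; apply: eq_bigr => j _.
have -> : (t - k.+1 = t.-1 - k)%N by case: t k => [[]//|t k]; rewrite subSS.
rewrite [in RHS]mxE ![in LHS]mxE !mxtens_indexK/= big_mxtens.
congr (_ * _); last by rewrite 2![RHS]mxE.
rewrite (bigD1 k)//= [X in _ + X]big1 => [|l lk]; last first.
  apply: big1 => j' _; rewrite tensmxE [1%:M _ _]mxE (negbTE lk).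
  by rewrite mul0r mulr0.
rewrite addr0; apply: eq_bigr => j' _.
by rewrite tensmxE !mxE eqxx mul1r mxtens_indexK.
Qed.

End stacked_noise.

(** * Decay of the initial state and the final estimate *)

Lemma exists_geometric_le (R : realType) (a b e : R) :
  0 <= a -> a < 1 -> 0 < e ->
  exists N, forall t, (N <= t)%N -> a ^+ t * b <= e.
Proof.
move=> a0 a1 e0.
have : a ^+ n * b @[n --> \oo] --> 0 * b.
  by apply: cvgMr_tmp; apply: cvg_expr; rewrite ger0_norm.
rewrite mul0r => /cvgr_lt /(_ _ e0) [N _ Ne].
by exists N => t Nt; apply/ltW/Ne.
Qed.

Theorem mainTheorem3 (R : realType) (nx nv nw : nat)
    (A : 'M[R]_nx) (D : 'M[R]_(nx, nv)) (E : 'M[R]_(nx, nw)) (Sw : 'M[R]_nw)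
    (eps d : R) (P : 'M[R]_nx) (r : R)
    (hSw : posdef Sw) (heps0 : 0 < eps) (heps1 : eps < 1) (hd : 0 <= d)
    (hA : specnorm A < 1) (hAE : reachable A E)
    (hP : posdef P) (hlyap : A *m P *m A^T - P + E *m Sw *m E^T = 0)
    (hr0 : 0 < r)
    (hr : r ^+ 2 > (specnorm D / (1 - specnorm A) * d
                    + Num.sqrt (1 / eps * \tr P)) ^+ 2) :
  cvar_ultimate_bound A D E Sw eps d (fun x => enorm x ^+ 2 - r ^+ 2).
Proof.
move=> x0.
set c := specnorm D / (1 - specnorm A) * d in hr.
set s := Num.sqrt _ in hr.
have c0 : 0 <= c.
  by rewrite mulr_ge0// divr_ge0 ?specnorm_ge0// subr_ge0 ltW.
have s0 : 0 <= s by exact: sqrtr_ge0.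
have cs_r : c + s < r.
  by rewrite -(@ltr_pXn2r _ 2)// nnegrE ?addr_ge0// ltW.
(* Half of the slack in [c + s < r] goes to each term: [b + s'] is exactly [r], and both are
   positive even if [c] or [s] is 0, so that [b / s'] and its inverse make sense. *)
pose e := (r - c - s) / 2.
have e0 : 0 < e by rewrite divr_gt0// -addrA -opprD subr_gt0.
pose b := c + e; pose s' := s + e.
have b0 : 0 < b by rewrite ltr_wpDl.
have s'0 : 0 < s' by rewrite ltr_wpDl.
have rE : r = b + s' by rewrite /b /s' /e; field.
have trP : \tr P / eps <= s' ^+ 2.
  apply: (@le_trans _ _ (s ^+ 2)).
    (* If the radicand were negative, [s] would be 0 and the bound would hold trivially. *)
    rewrite mulrC -[eps^-1]div1r /s; case: (leP 0 (1 / eps * \tr P)) => h.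
      by rewrite sqr_sqrtr.
    exact: le_trans (ltW h) (sqr_ge0 _).
  by rewrite ler_pXn2r// ?nnegrE ?lerDl ltW.
(* From time [N] on, the share [e] inside [b] absorbs the transient [|A|^t |x0|]; [N] is fixed
   before the input is introduced. *)
have [N NT] := exists_geometric_le (enorm x0) (specnorm_ge0 A) hA e0.
exists N.+1 => // v vd t /ltnW Nt; apply: ge_ereal_sup => _ [Q Qamb <-].
(* This weight makes [(1 + l^-1) b^2 + (1 + l) s'^2] equal to [(b + s')^2], that is [r^2]. *)
pose l := b / s'; have l0 : 0 < l by rewrite divr_gt0.
pose G := noise_gain A E t.
pose K (w : borelcV R (t * nw)) :=
  (1 + l) * enorm (G *m (w : 'cV[R]_(t * nw))) ^+ 2.
apply: (@le_trans _ _
   ((1 + l^-1) * b ^+ 2 - r ^+ 2 + ((1 + l) * \tr P) / eps)%:E); last first.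
  rewrite lee_fin -mulrA.
  have h : (1 + l) * (\tr P / eps) <= (1 + l) * s' ^+ 2.
    by rewrite ler_pM2l// ltr_wpDl.
  apply: le_trans (lerD (lexx _) h) _.
  rewrite le_eqVlt; apply/orP; left; apply/eqP.
  by rewrite rE /l; field; rewrite !gt_eqF.
have l1 : 0 <= 1 + l by rewrite addr_ge0 ?ltW.
apply: (@cvar_le _ _ _ _ _ _ _ _ K) => // [w|w|].
- by rewrite mulr_ge0 ?sqr_ge0.
- rewrite addrAC lerD2r /state trajectory_split noise_part_unstack.
  apply: le_trans (sqr_enormD_le _ _ l0) _.
  rewrite lerD2r ler_pM2l; last by rewrite ltr_wpDr// invr_ge0 ltW.
  rewrite ler_pXn2r ?nnegrE ?enorm_ge0 ?(ltW b0)//.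
  apply: le_trans (enorm_forced_part D x0 t hA (d := d) _) _.
    by move=> k; have [_] := vd k; apply.
  by rewrite -/c /b addrC lerD2l NT.
rewrite (_ : (\int[Q]_w (K w)%:E)%E =
  ((1 + l)%:E * \int[Q]_w (enorm (G *m (w : 'cV[R]_(t * nw))) ^+ 2)%:E)%E);
  last first.
  by rewrite -integralZl//; exact: (integrable_sqr_enorm_mulmx Qamb).
rewrite (integral_sqr_enorm_mulmx Qamb) -EFinM lee_fin ler_wpM2l//.
by rewrite trace_noise_gain trace_lyapunov_sum_le.
Qed.
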